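(* Let $N\ge0$; for $t=1,\dots,N$ let $p_t\ge1$ and positive integers $n_{t1}\ge\dots\ge n_{tp_t}$ be given, and let $(\alpha_t,\beta_t)\in\mathbb C^2\setminus\{0\}$ be such that the points $(\alpha_t:\beta_t)\in\mathbb{CP}^1$ are pairwise different. Let $\mathfrak g$ have basis $g,h_1,h_2,e^i_{tj},f^i_{tj}$ ($t=1,\dots,N$, $i=1,\dots,p_t$, $j=1,\dots,n_{ti}$) with brackets $[g,h_1]=h_1$, $[g,h_2]=h_2$, $[g,e^i_{tk}]=e^i_{tk}$, $[e^i_{tj},f^i_{tk}]=e^i_{t,j-k}$ if $j>k$, $[e^i_{tj},f^i_{tk}]=\alpha_th_1+\beta_th_2$ if $j=k$, all other brackets of basis elements (not determined by these and antisymmetry) being zero. Then $\mathfrak g$ is a Lie algebra whose Jordan–Kronecker invariants consist of one Kronecker $3\times3$ block and the Jordan tuples $J_{\lambda_t}(2n_{t1},\dots,2n_{tp_t})$, $t=1,\dots,N$.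
   Context: For a finite-dimensional complex Lie algebra $\mathfrak g$ and $x\in\mathfrak g^*$, let $\mathcal A_x$ be the skew form $(\xi,\eta)\mapsto\langle x,[\xi,\eta]\rangle$. By the Jordan–Kronecker theorem, a pair of skew forms on a finite-dimensional complex vector space admits a basis in which both are block-diagonal with Jordan $2n\times2n$ blocks with eigenvalues $\mu\in\mathbb C\cup\{\infty\}$ ($A_i=\begin{pmatrix}0&J_\mu\\-J_\mu^T&0\end{pmatrix}$, $B_i=\begin{pmatrix}0&I_n\\-I_n&0\end{pmatrix}$) and Kronecker $(2k-1)\times(2k-1)$ blocks ($A_i=\begin{pmatrix}0&P\\-P^T&0\end{pmatrix}$, $B_i=\begin{pmatrix}0&Q\\-Q^T&0\end{pmatrix}$, $P=(I_{k-1}|0)$, $Q=(0|I_{k-1})$); block data grouped by eigenvalue are unique. The JK invariants of $\mathfrak g$ are the Kronecker sizes and the Jordan tuples $J_{\lambda_i}(\dots)$ (sizes of Jordan blocks with common eigenvalue $\lambda_i$; distinct eigenvalues as distinct formal symbols) of $(\mathcal A_x,\mathcal A_a)$ for $(x,a)$ in a nonempty Zariski open subset of $\mathfrak g^*\times\mathfrak g^*$. *)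

(* Defs.v *)
From HB Require Import structures.
From mathcomp Require Import all_boot all_algebra.
From mathcomp Require Import Rstruct complex.
From mathcomp Require mpoly.

Set Implicit Arguments.
Unset Strict Implicit.
Unset Printing Implicit Defensive.
Import GRing.Theory.
Local Open Scope ring_scope.

Definition C : closedFieldType := (Rdefinitions.R)[i].

(** Elements of g (and of g^* ) are coordinate vectors I -> C.  c i j k is the
    coefficient of e_k in [e_i, e_j]. *)
Definition lie_br (I : finType) (c : I -> I -> I -> C) (u v : I -> C) : I -> C :=
  fun k => \sum_(i : I) \sum_(j : I) u i * v j * c i j k.

Definition is_lie_algebra (I : finType) (c : I -> I -> I -> C) : Prop :=
  (forall u k, lie_br c u u k = 0) /\
  (forall u v w k,
     lie_br c u (lie_br c v w) k + lie_br c v (lie_br c w u) k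
       + lie_br c w (lie_br c u v) k = 0).

(** The skew form A_x(xi, eta) = <x, [xi, eta]>, as a Gram matrix in the basis
    (e_i), the basis being enumerated by enum_val. *)
Definition Aform (I : finType) (c : I -> I -> I -> C) (x : I -> C)
  : 'M[C]_#|{: I}| :=
  \matrix_(i, j) \sum_(k : I) x k * c (enum_val i) (enum_val j) k.

Definition pair_coords (I : finType) (x a : I -> C) : 'I_(#|{: I}| + #|{: I}|) -> C :=
  fun r => match split r with
           | inl i => x (enum_val i)
           | inr i => a (enum_val i)
           end.

Definition zariski_open2 (I : finType) (U : (I -> C) -> (I -> C) -> Prop) : Prop :=
  exists S : mpoly.mpoly (#|{: I}| + #|{: I}|) C -> Prop,
    forall x a, ~ U x a <-> (forall Q, S Q -> mpoly.meval (pair_coords x a) Q = 0).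

Definition generically2 (I : finType) (P : (I -> C) -> (I -> C) -> Prop) : Prop :=
  exists U : (I -> C) -> (I -> C) -> Prop,
    zariski_open2 U /\ (exists x a, U x a) /\ (forall x a, U x a -> P x a).

(** A block: JB mu k is a Jordan 2k x 2k block with eigenvalue mu
    (None = infinity); KB k is a Kronecker (2k-1) x (2k-1) block. *)
Inductive jkblock := JB of option C & nat | KB of nat.

Definition jk_size (b : jkblock) : nat :=
  match b with JB _ k => k.*2 | KB k => (k.*2).-1 end.

Definition jk_wf (b : jkblock) : bool :=
  match b with JB _ k => (0 < k)%N | KB k => (0 < k)%N end.

Definition jordanJ (mu : C) (i j : nat) : C :=
  if j == i then mu else if j == i.+1 then 1 else 0.
Definition idI (i j : nat) : C := if j == i then 1 else 0.
(** P = (I_{k-1} | 0), Q = (0 | I_{k-1}) *)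
Definition kronP (i j : nat) : C := if j == i then 1 else 0.
Definition kronQ (i j : nat) : C := if j == i.+1 then 1 else 0.

(** the skew matrix [[0, M], [-M^T, 0]] whose upper-left zero block is r x r *)
Definition skewblk (r : nat) (M : nat -> nat -> C) (i j : nat) : C :=
  if ((i < r) && (r <= j))%N then M i (j - r)%N
  else if ((r <= i) && (j < r))%N then - M j (i - r)%N
  else 0.

Definition blockA (b : jkblock) : nat -> nat -> C :=
  match b with
  | JB (Some mu) k => skewblk k (jordanJ mu)
  | JB None k => skewblk k idI
  | KB k => skewblk k.-1 kronP
  end.

Definition blockB (b : jkblock) : nat -> nat -> C :=
  match b with
  | JB (Some mu) k => skewblk k idI
  | JB None k => skewblk k (jordanJ 0)
  | KB k => skewblk k.-1 kronQ
  end.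

Fixpoint blockdiag (f : jkblock -> nat -> nat -> C) (bs : seq jkblock)
    (i j : nat) : C :=
  match bs with
  | [::] => 0
  | b :: bs' =>
      let s := jk_size b in
      if ((i < s) && (j < s))%N then f b i j
      else if ((s <= i) && (s <= j))%N then blockdiag f bs' (i - s)%N (j - s)%N
      else 0
  end.

Definition jk_decomp (m : nat) (A B : 'M[C]_m) (bs : seq jkblock) : Prop :=
  all jk_wf bs /\ sumn (map jk_size bs) = m /\
  exists T : 'M[C]_m, T \in unitmx /\
    T *m A *m T^T = \matrix_(i, j) blockdiag blockA bs i j /\
    T *m B *m T^T = \matrix_(i, j) blockdiag blockB bs i j.

(** index set of the e^i_{tj} (and f^i_{tj}): t < N, i < p t, j < n t i
    (0-based; the paper's indices are i+1, j+1) *)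
Definition EFidx (N : nat) (p : 'I_N -> nat) (n : forall t : 'I_N, 'I_(p t) -> nat)
  : finType := {t : 'I_N & {i : 'I_(p t) & 'I_(n t i)}}.

(** basis: inl 0 = g, inl 1 = h_1, inl 2 = h_2, inr (true, e) = e^i_{tj},
    inr (false, e) = f^i_{tj} *)
Definition gidx (N : nat) (p : 'I_N -> nat) (n : forall t : 'I_N, 'I_(p t) -> nat)
  : finType := ('I_3 + (bool * EFidx n))%type.

Definition tt_of N p n (e : EFidx (N:=N) (p:=p) n) : 'I_N := tag e.
Definition ii_of N p n (e : EFidx (N:=N) (p:=p) n) : nat := val (tag (tagged e)).
Definition jj_of N p n (e : EFidx (N:=N) (p:=p) n) : nat := val (tagged (tagged e)).

(** The brackets listed in the statement (one orientation only):
    rule a b l = coefficient of basis vector l in [a, b] for the listed pairs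
    [g,h1]=h1, [g,h2]=h2, [g,e]=e, [e^i_{tj}, f^i_{tk}] (j >= k); 0 otherwise. *)
Definition rule (N : nat) (p : 'I_N -> nat) (n : forall t : 'I_N, 'I_(p t) -> nat)
    (alpha beta : 'I_N -> C) (a b l : gidx n) : C :=
  match a, b with
  | inl x, inl y =>
      if (val x == 0%N) && (val y == 1%N) then (l == inl y)%:R
      else if (val x == 0%N) && (val y == 2%N) then (l == inl y)%:R
      else 0
  | inl x, inr (true, e) => if val x == 0%N then (l == b)%:R else 0
  | inr (true, e1), inr (false, e2) =>
      if (tt_of e1 == tt_of e2) && (ii_of e1 == ii_of e2) then
        if (jj_of e2 < jj_of e1)%N then
          (* e^i_{t, j-k} ; 0-based index (j-1)-(k-1)-1 *)
          match l with
          | inr (true, e3) =>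
              ((tt_of e3 == tt_of e1) && (ii_of e3 == ii_of e1)
                 && (jj_of e3 == jj_of e1 - jj_of e2 - 1)%N)%:R
          | _ => 0
          end
        else if jj_of e2 == jj_of e1 then
          match l with
          | inl z => if val z == 1%N then alpha (tt_of e1)
                     else if val z == 2%N then beta (tt_of e1) else 0
          | _ => 0
          end
        else 0
      else 0
  | _, _ => 0
  end.

Definition gconst (N : nat) (p : 'I_N -> nat) (n : forall t : 'I_N, 'I_(p t) -> nat)
    (alpha beta : 'I_N -> C) (a b l : gidx n) : C :=
  rule alpha beta a b l - rule alpha beta b a l.

Definition expected_blocks (N : nat) (p : 'I_N -> nat)
    (n : forall t : 'I_N, 'I_(p t) -> nat) (lam : 'I_N -> option C) : seq jkblock :=
  KB 2 :: flatten [seq [seq JB (lam t) (n t i) | i <- enum 'I_(p t)] | t <- enum 'I_N].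

(* Main.v *)
(** With V the ideal spanned by the h's and the e's and W the span of g and the
    f's, both V and W are abelian and W acts on V by commuting operators: g by the
    identity, f^i_{tk} by a power of the shift along the chain e^i_{t1}, e^i_{t2}, ....
    This gives the Jacobi identity.  Both A_x and A_a then pair V with W only.  Put
    d_t(x) = alpha_t x_{h_1} + beta_t x_{h_2} and let x_{h_1} a_{h_2} - x_{h_2} a_{h_1}
    be nonzero.  Then g, h_1, h_2 span a Kronecker 3 x 3 block, and subtracting
    combinations of h_1, h_2 makes the e's orthogonal to g for both forms.  What is
    left splits into blocks indexed by (t, i), where e and f are paired by lower triangular
    Toeplitz matrices L_x and L_a with diagonals d_t(x) and d_t(a).  If d_t(a) is nonzero, the
    eigenvalue is d_t(x) / d_t(a), and it has a single Jordan block as soon as the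
    subdiagonal of L_x - (d_t(x) / d_t(a)) L_a does not vanish.  Finally
    d_t(x) d_s(a) - d_s(x) d_t(a) is (alpha_t beta_s - alpha_s beta_t) times the above
    2 x 2 determinant, so the eigenvalues are distinct. *)

Require Import Defs.
From mathcomp Require Import all_boot all_algebra.
From mathcomp Require Import Rstruct complex.
From mathcomp Require mpoly.
From mathcomp Require Import ring zify.
Import GRing.Theory.
Local Open Scope ring_scope.

Set Implicit Arguments.
Unset Strict Implicit.
Unset Printing Implicit Defensive.

(** * Simultaneous reduction of two lower triangular matrices *)

Lemma trig_unitmx (F : fieldType) n (L : 'M[F]_n) :
  (forall i j : 'I_n, (i < j)%N -> L i j = 0) -> (forall i, L i i != 0) ->
  L \in unitmx.
Proof.
move=> L0 Ld; rewrite unitmxE det_trig; last exact/is_trig_mxP.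
by rewrite unitfE; apply/prodf_neq0 => i _.
Qed.

(** [L^-1 M] is strictly lower triangular with nonzero subdiagonal, hence nilpotent of maximal index
    with the first unit vector as cyclic vector. If [W] has the iterates of that vector as columns,
    [U = W^-1 L^-1] and [V = W] work. *)
Lemma triangular_jordan_pair (F : fieldType) n (L M : 'M[F]_n) :
    (forall i j : 'I_n, (i < j)%N -> L i j = 0) -> (forall i, L i i != 0) ->
    (forall i j : 'I_n, (i <= j)%N -> M i j = 0) ->
    (forall i j : 'I_n, i = j.+1 :> nat -> M i j != 0) ->
  exists U V : 'M[F]_n, U *m L *m V = 1%:M /\
    U *m M *m V = \matrix_(i, j) (i == j.+1 :> nat)%:R.
Proof.
move=> L0 Ld M0 Md; have Lu := trig_unitmx L0 Ld.
(* In the basis w_r = K^r w_0, with K = L^-1 M, the matrix K is a single Jordan cell. *)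
have [w w_0 wS] : exists2 w : nat -> 'cV[F]_n, w 0 = \col_i (i == 0 :> nat)%:R &
    forall r, w r.+1 = invmx L *m (M *m w r).
  by exists (fun r => iter r (fun v => invmx L *m (M *m v)) (\col_i (i == 0 :> nat)%:R)).
have Lw r : L *m w r.+1 = M *m w r by rewrite wS mulKVmx.
(* [w r] starts exactly at coordinate [r]: the vectors with [r < n] form a triangular matrix with
   nonzero diagonal, and [w n = 0]. *)
have wP r (i : 'I_n) : ((i < r)%N -> w r i 0 = 0) /\ (i = r :> nat -> w r i 0 != 0).
  elim: r i => [|r IH] i; first by split=> // i0; rewrite w_0 mxE i0 eqxx oner_eq0.
  (* Forward substitution: row [k] of [L *m w r.+1] reduces to its diagonal term once the earlier
     coordinates vanish. *)
  have row_eq (k : 'I_n) : (forall j : 'I_n, (j < k)%N -> w r.+1 j 0 = 0) ->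
      L k k * w r.+1 k 0 = (M *m w r) k 0.
    move=> z; rewrite -Lw mxE (bigD1 k) //= big1 ?addr0 // => j jk.
    have [/L0->|] := ltnP k j; first by rewrite mul0r.
    by rewrite leq_eqVlt (negPf jk : (j == k :> nat) = false) => /z->; rewrite mulr0.
  have w0 (k : 'I_n) : (k < r.+1)%N -> w r.+1 k 0 = 0.
    have [m] := ubnP k; elim: m k => // m IHm k km kr.
    have /row_eq : forall j : 'I_n, (j < k)%N -> w r.+1 j 0 = 0.
      by move=> j jk; apply: IHm; [apply: leq_trans jk _ | apply: ltn_trans jk kr].
    rewrite mxE big1 => [/eqP|j _]; first by rewrite mulf_eq0 (negPf (Ld k)) => /eqP.
    have [/M0->|jk] := leqP k j; first by rewrite mul0r.
    by rewrite (IH j).1 ?mulr0 //; apply: leq_trans jk _.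
  split=> [|ir]; first exact: w0.
  have rn : (r < n)%N by rewrite ltnW // -ir.
  have : L i i * w r.+1 i 0 = (M *m w r) i 0.
    by apply: row_eq => j ji; apply: w0; rewrite -ir.
  rewrite mxE (bigD1 (Ordinal rn)) //= big1 => [|j jr].
    rewrite addr0 => e; apply: contraTneq isT => wi0; move/eqP: e.
    by rewrite wi0 mulr0 eq_sym mulf_eq0 (negPf (Md _ _ _)) ?(negPf ((IH _).2 _)).
  have [/M0->|jk] := leqP i j; first by rewrite mul0r.
  have jr' : (j < r)%N by rewrite ltn_neqAle jr -ltnS -ir.
  by rewrite (IH j).1 ?mulr0.
pose W : 'M[F]_n := \matrix_(i, j) w j i 0.
have Wu : W \in unitmx.
  by apply: trig_unitmx => [i j ij|i]; rewrite mxE; [apply: (wP j i).1|apply: (wP i i).2].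
pose S : 'M[F]_n := \matrix_(i, j) (i == j.+1 :> nat)%:R.
have KW : invmx L *m M *m W = W *m S.
  apply/matrixP => i j; rewrite -mulmxA.
  have -> : (invmx L *m (M *m W)) i j = w j.+1 i 0.
    rewrite wS !mxE; apply: eq_bigr => k _; congr (_ * _).
    by rewrite !mxE; apply: eq_bigr => l _; rewrite !mxE.
  rewrite mxE; have [jn|nj] := ltnP j.+1 n.
    rewrite (bigD1 (Ordinal jn)) //= big1 => [|k kj]; first by rewrite !mxE eqxx mulr1 addr0.
    by rewrite !mxE (negPf (kj : (k != j.+1 :> nat))) mulr0.
  (* Last column: [w n = 0] on the left, and the last column of [S] is zero on the right. *)
  rewrite (wP _ _).1 ?big1 ?(leq_trans _ nj) // => k _.
  by rewrite !mxE ltn_eqF ?mulr0 // (leq_trans _ nj).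
exists (invmx W *m invmx L), W; split; first by rewrite mulmxKV // mulVmx.
by rewrite -!mulmxA (mulmxA _ M) KW mulKmx.
Qed.

(** * Gram matrices of stacked block bases *)

Definition gram (I : finType) (G : I -> I -> C) (u v : I -> C) : C :=
  \sum_i \sum_j u i * v j * G i j.

Section Stack.
Variables (K : eqType) (I : finType) (b : K -> jkblock) (vs : K -> nat -> I -> C).

Fixpoint stack (ks : seq K) (r : nat) : I -> C :=
  if ks is k :: ks' then
    if (r < jk_size (b k))%N then vs k r else stack ks' (r - jk_size (b k))
  else fun=> 0.

Lemma stackP ks r : (r < sumn [seq jk_size (b k) | k <- ks])%N ->
  exists k s, [/\ k \in ks, (s < jk_size (b k))%N & stack ks r = vs k s].
Proof.
elim: ks r => //= k ks IH r rk; case: ifP => rb.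
  by exists k, r; rewrite inE eqxx.
case: (IH (r - jk_size (b k))%N) => [|k' [s [k'ks sk ->]]]; first by lia.
by exists k', s; rewrite inE k'ks orbT.
Qed.

Lemma gram_stack (f : jkblock -> nat -> nat -> C) (G : I -> I -> C) ks i j :
    uniq ks ->
    (forall k r s, (r < jk_size (b k))%N -> (s < jk_size (b k))%N ->
       gram G (vs k r) (vs k s) = f (b k) r s) ->
    (forall k k' r s, k != k' ->
       (r < jk_size (b k))%N -> (s < jk_size (b k'))%N ->
       gram G (vs k r) (vs k' s) = 0) ->
    (i < sumn [seq jk_size (b k) | k <- ks])%N ->
    (j < sumn [seq jk_size (b k) | k <- ks])%N ->
  gram G (stack ks i) (stack ks j) = blockdiag f (map b ks) i j.
Proof.
move=> uk Gd Go; elim: ks uk i j => //= k ks IH /andP[kks /IH{}IH] i j ik jk.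
have neq k' : k' \in ks -> k != k' by move=> k'ks; apply: contraNneq kks => ->.
have [ib|ib] := ltnP i (jk_size (b k)); have [jb|jb] := ltnP j (jk_size (b k)) => /=.
- exact: Gd.
- have [|k' [s [/neq kk' sk ->]]] := @stackP ks (j - jk_size (b k)); first by lia.
  exact: Go.
- have [|k' [s [/neq kk' sk ->]]] := @stackP ks (i - jk_size (b k)); first by lia.
  by apply: Go => //; rewrite eq_sym.
- by apply: IH; lia.
Qed.

End Stack.

(* Each basis vector of the block is singled out by one column of one of the two
   forms; hence the forms of a block have no common kernel. *)
Definition pivoted (b : jkblock) : Prop :=
  forall r, (r < jk_size b)%N -> exists (f : jkblock -> nat -> nat -> C) j,
    [/\ f = blockA \/ f = blockB, (j < jk_size b)%N, f b r j != 0 &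
        forall i, (i < jk_size b)%N -> i != r -> f b i j = 0].

(** For a finite eigenvalue the second form is the standard symplectic one, each column of which has
    a single nonzero entry; row [r] is matched with the column at distance [k]. *)
Lemma pivoted_JB mu k : pivoted (JB (Some mu) k).
Proof.
move=> r /= rk; exists blockB, (if (r < k)%N then r + k else r - k)%N.
split; [by right | by rewrite /=; case: (ltnP r k); lia | |].
  case: (ltnP r k) => rk'; rewrite /= /skewblk.
    rewrite rk' leq_addl /= addnK /idI eqxx; exact: oner_neq0.
  have -> : (r - k < k)%N by lia.
  by rewrite [(r < k)%N]ltnNge rk' /= /idI eqxx oppr_eq0 oner_neq0.
move=> i ik ir; rewrite /= /skewblk /idI; case: (ltnP r k) => rk' /=.
  have -> : (r + k < k)%N = false by lia.
  rewrite andbF; case: ltnP => ik' //=.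
  by rewrite leq_addl addnK eq_sym (negPf ir).
have rk'' : (r - k < k)%N by lia.
rewrite [(k <= _)%N]leqNgt rk'' andbF andbT; case: ltnP => // ik' /=.
by rewrite ifF ?oppr0 //; lia.
Qed.

(** A skew form in dimension 3 is degenerate, so both forms serve: the first one singles out vectors
    0 and 1, the second one vector 2. *)
Lemma pivoted_KB2 : pivoted (KB 2).
Proof.
have n10 : (1 : C) != 0 by exact: oner_neq0.
case=> [|[|[|//]]] _; [exists blockA, 1 | exists blockA, 0 | exists blockB, 0];
  split=> //; try (by left); try (by right);
  rewrite /= /skewblk /kronP /kronQ /= ?oppr_eq0 //;
  by case=> [|[|[|//]]] //=; rewrite oppr0.
Qed.

Lemma pivoted_blockdiag (K : Type) (b : K -> jkblock) (ks : seq K) r :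
    (forall k, pivoted (b k)) -> (r < sumn [seq jk_size (b k) | k <- ks])%N ->
  exists (f : jkblock -> nat -> nat -> C) j,
    [/\ f = blockA \/ f = blockB, (j < sumn [seq jk_size (b k) | k <- ks])%N,
        blockdiag f (map b ks) r j != 0 &
        forall i, i != r -> (i < sumn [seq jk_size (b k) | k <- ks])%N ->
          blockdiag f (map b ks) i j = 0].
Proof.
move=> bP; elim: ks r => //= k ks IH r rk.
have [rb|rb] := ltnP r (jk_size (b k)).
  have [f [j [fP jb frj fij]]] := bP k r rb.
  exists f, j; split; rewrite // ?jb ?rb ?ltn_addr //= => i ir ik.
  by have [ib|ib] := ltnP i (jk_size (b k)); rewrite /= ?fij // leqNgt jb.
have [|f [j [fP jb frj fij]]] := IH (r - jk_size (b k))%N; first by lia.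
exists f, (j + jk_size (b k))%N; split=> //; first by rewrite addnC ltn_add2l.
  by rewrite leq_addl addnK.
move=> i ir ik; have [ib|ib] := ltnP i (jk_size (b k)); rewrite /=.
  by rewrite ltnNge leq_addl.
by rewrite leq_addl addnK; apply: fij; lia.
Qed.

Lemma gramE (I : finType) (G : I -> I -> C) (vs : nat -> I -> C) :
  let T : 'M[C]_#|{: I}| := \matrix_(r, i) vs r (enum_val i) in
  T *m (\matrix_(i, j) G (enum_val i) (enum_val j)) *m T^T =
  \matrix_(r, s) gram G (vs r) (vs s).
Proof.
apply/matrixP => r s; rewrite !mxE /gram.
rewrite (reindex (@enum_val I predT)) /=; last exact/onW_bij/enum_val_bij.
under eq_bigr do rewrite !mxE big_distrl /=.
rewrite exchange_big /=; apply: eq_bigr => i _.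
rewrite (reindex (@enum_val I predT)) /=; last exact/onW_bij/enum_val_bij.
by apply: eq_bigr => j _; rewrite !mxE mulrAC.
Qed.

(** Reduces a Jordan-Kronecker decomposition to the values of the two forms on explicit vectors; the
    pivots supply the linear independence of these vectors. *)
Lemma jk_decomp_stack (K : eqType) (I : finType) (b : K -> jkblock)
    (vs : K -> nat -> I -> C) (ks : seq K) (GA GB : I -> I -> C) :
    uniq ks -> (forall k, jk_wf (b k)) -> (forall k, pivoted (b k)) ->
    sumn [seq jk_size (b k) | k <- ks] = #|I| ->
    (forall k r s, (r < jk_size (b k))%N -> (s < jk_size (b k))%N ->
       gram GA (vs k r) (vs k s) = blockA (b k) r s /\
       gram GB (vs k r) (vs k s) = blockB (b k) r s) ->
    (forall k k' r s, k != k' ->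
       (r < jk_size (b k))%N -> (s < jk_size (b k'))%N ->
       gram GA (vs k r) (vs k' s) = 0 /\ gram GB (vs k r) (vs k' s) = 0) ->
  jk_decomp (\matrix_(i, j) GA (enum_val i) (enum_val j))
            (\matrix_(i, j) GB (enum_val i) (enum_val j) : 'M_#|{: I}|) (map b ks).
Proof.
move=> uk wf piv sz Gd Go; split; first by rewrite all_map; apply/allP => k _; apply: wf.
split; first by rewrite -map_comp.
pose T : 'M[C]_#|{: I}| := \matrix_(r, i) stack b vs ks r (enum_val i).
have lt_sz (r : 'I_#|{: I}|) : (r < sumn [seq jk_size (b k) | k <- ks])%N by rewrite sz.
have eA : T *m (\matrix_(i, j) GA (enum_val i) (enum_val j)) *m T^T =
    \matrix_(i, j) blockdiag blockA (map b ks) i j.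
  rewrite gramE; apply/matrixP => r s; rewrite !mxE; apply: gram_stack => //.
    by move=> k ? ? ? ?; apply: (Gd k _ _ _ _).1.
  by move=> k k' ? ? ? ? ?; apply: (Go k k' _ _ _ _ _).1.
have eB : T *m (\matrix_(i, j) GB (enum_val i) (enum_val j)) *m T^T =
    \matrix_(i, j) blockdiag blockB (map b ks) i j.
  rewrite gramE; apply/matrixP => r s; rewrite !mxE; apply: gram_stack => //.
    by move=> k ? ? ? ?; apply: (Gd k _ _ _ _).2.
  by move=> k k' ? ? ? ? ?; apply: (Go k k' _ _ _ _ _).2.
(* A vector u with u T = 0 lies in the common kernel of the two target forms. *)
exists T; split=> //; rewrite -row_free_unit; apply: inj_row_free => u uT.
apply/rowP => r; rewrite mxE.
have [f [j [fP jb frj fij]]] := pivoted_blockdiag piv (lt_sz r).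
have jI : (j < #|{: I}|)%N by rewrite -sz.
have : u *m (\matrix_(i, j) blockdiag f (map b ks) i j) = 0 :> 'rV_#|{: I}|.
  by case: fP => ->; rewrite -?eA -?eB !mulmxA uT !mul0mx.
move/rowP/(_ (Ordinal jI)); rewrite !mxE (bigD1 r) //= big1 => [/eqP|i ir].
  by rewrite addr0 mxE mulf_eq0 (negPf frj) orbF => /eqP.
by rewrite mxE /= fij ?mulr0.
Qed.

(** * Lie algebras from commuting actions *)

(** Let D be the bilinear product given by [act], so that [u, v] = D u v - D v u. The second
    hypothesis gives D (D u v) x = 0 and the third makes the operators D u commute. Hence [u,
    [v, x]] = D u (D v x) - D u (D x v), and the six terms of the cyclic sum cancel in pairs. *)
Lemma lie_algebra_of_action (I : finType) (c act : I -> I -> I -> C) :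
    (forall i j k, c i j k = act i j k - act j i k) ->
    (forall i j k l m, act i j k * act k l m = 0) ->
    (forall i j k m,
       \sum_l act j k l * act i l m = \sum_l act i k l * act j l m) ->
  is_lie_algebra c.
Proof.
move=> cE act0 actC.
pose D (u v : I -> C) : I -> C := fun k => \sum_i \sum_j u i * v j * act i j k.
have brE u v k : lie_br c u v k = D u v k - D v u k.
  rewrite /lie_br /D [X in _ = _ - X]exchange_big -sumrB; apply: eq_bigr => i _.
  by rewrite -sumrB; apply: eq_bigr => j _; rewrite cE; ring.
have DD0 (u v x : I -> C) l : D (D u v) x l = 0.
  rewrite /D big1 // => i _; rewrite big1 // => j _.
  rewrite !big_distrl /= big1 // => a _; rewrite !big_distrl /= big1 // => b _.
  transitivity (u a * v b * x j * (act a b i * act i j l)); first by ring.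
  by rewrite act0 mulr0.
have D_DE (u v x : I -> C) l :
    D u (D v x) l = \sum_i \sum_a \sum_b u i * v a * x b * \sum_j act a b j * act i j l.
  rewrite /D; apply: eq_bigr => i _.
  transitivity (\sum_j \sum_a \sum_b u i * v a * x b * (act a b j * act i j l)).
    apply: eq_bigr => j _; rewrite big_distrr big_distrl; apply: eq_bigr => a _.
    rewrite big_distrr big_distrl; apply: eq_bigr => b _ /=; ring.
  rewrite exchange_big; apply: eq_bigr => a _; rewrite exchange_big.
  by apply: eq_bigr => b _; rewrite big_distrr.
have DC (u v x : I -> C) l : D u (D v x) l = D v (D u x) l.
  rewrite !D_DE exchange_big; apply: eq_bigr => a _; apply: eq_bigr => i _.
  by apply: eq_bigr => b _; rewrite actC; congr (_ * _); ring.
have brD (u v x : I -> C) l :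
    lie_br c u (lie_br c v x) l
    = D u (D v x) l - D u (D x v) l.
  rewrite brE.
  have DB (y1 y2 y3 : I -> C) :
      D y1 (lie_br c y2 y3) l = D y1 (D y2 y3) l - D y1 (D y3 y2) l.
    rewrite /D -sumrB; apply: eq_bigr => i _; rewrite -sumrB.
    by apply: eq_bigr => j _; rewrite brE /D; ring.
  have BD (y1 y2 y3 : I -> C) :
      D (lie_br c y2 y3) y1 l = D (D y2 y3) y1 l - D (D y3 y2) y1 l.
    rewrite /D -sumrB; apply: eq_bigr => i _; rewrite -sumrB.
    by apply: eq_bigr => j _; rewrite brE /D; ring.
  by rewrite DB BD !DD0 !subr0.
split; [by move=> u k; rewrite brE subrr | move=> u v w m].
by rewrite !brD (DC v u w) (DC w u v) (DC w v u); ring.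
Qed.

(** * Coordinates on the algebra and the half of the form given by [rule] *)

Section Algebra.
Variables (N : nat) (p : 'I_N -> nat) (n : forall t : 'I_N, 'I_(p t) -> nat).
Variables (alpha beta : 'I_N -> C).

Let g0 : 'I_3 := @Ordinal 3 0 isT.
Let h1 : 'I_3 := @Ordinal 3 1 isT.
Let h2 : 'I_3 := @Ordinal 3 2 isT.

Lemma sum_gidx (F : gidx n -> C) :
  \sum_a F a = F (inl g0) + F (inl h1) + F (inl h2)
    + (\sum_e F (inr (true, e)) + \sum_e F (inr (false, e))).
Proof.
rewrite big_sumType /=; congr (_ + _).
  rewrite !big_ord_recl big_ord0 addr0 addrA.
  by congr (F (inl _) + F (inl _) + F (inl _)); apply: val_inj.
transitivity (\sum_b \sum_e F (inr (b, e))); last by rewrite big_bool.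
by rewrite pair_big; apply: eq_bigr => -[].
Qed.

Definition mkEF (t : 'I_N) (i : 'I_(p t)) (j : 'I_(n i)) : EFidx n :=
  existT (fun t => {i : 'I_(p t) & 'I_(n i)}) t (existT (fun i => 'I_(n i)) i j).

(** The second indices are compared as natural numbers, because they live in types depending on the
    first ones. *)
Definition same_block (e f : EFidx n) := (tt_of e == tt_of f) && (ii_of e == ii_of f).

Definition dval (t : 'I_N) (x : gidx n -> C) : C :=
  alpha t * x (inl h1) + beta t * x (inl h2).

(** [rule] lists each bracket in one orientation; the skew form of x is the antisymmetrization of
    this form. *)
Definition half_form (x : gidx n -> C) (a b : gidx n) : C :=
  \sum_l x l * rule alpha beta a b l.

Definition ef_form (x : gidx n -> C) (e f : EFidx n) : C :=
  half_form x (inr (true, e)) (inr (false, f)).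

Definition gvec (c0 c1 c2 : C) (Q P : EFidx n -> C) : gidx n -> C := fun a =>
  match a with
  | inl i => if val i == 0%N then c0 else if val i == 1%N then c1 else c2
  | inr (true, e) => Q e
  | inr (false, e) => P e
  end.

Lemma sum_delta (x : gidx n -> C) (a : gidx n) : \sum_l x l * (l == a)%:R = x a.
Proof.
rewrite (bigD1 a) //= eqxx mulr1 big1 ?addr0 // => l la.
by rewrite (negPf la) mulr0.
Qed.

Lemma sum_mul0 (x : gidx n -> C) : \sum_(l : gidx n) x l * 0 = 0.
Proof. by rewrite big1 // => l _; rewrite mulr0. Qed.

(** On basis vectors the half form can be nonzero only at (g, h), (g, e) and (e, f). All later
    values of the skew forms are computed from this formula. *)
Lemma gram_half_form x c0 c1 c2 Q P c0' c1' c2' Q' P' :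
  gram (half_form x) (gvec c0 c1 c2 Q P) (gvec c0' c1' c2' Q' P') =
  c0 * (c1' * x (inl h1) + c2' * x (inl h2) + \sum_e Q' e * x (inr (true, e)))
  + \sum_e \sum_f Q e * P' f * ef_form x e f.
Proof.
pose R := half_form x.
have Rgg : R (inl g0) (inl g0) = 0 by apply: sum_mul0.
have Rg1 : R (inl g0) (inl h1) = x (inl h1) by apply: sum_delta.
have Rg2 : R (inl g0) (inl h2) = x (inl h2) by apply: sum_delta.
have Rge e : R (inl g0) (inr (true, e)) = x (inr (true, e)) by apply: sum_delta.
have Rgf f : R (inl g0) (inr (false, f)) = 0 by apply: sum_mul0.
have R1 b : R (inl h1) b = 0 by case: b => [i|[[] e]]; apply: sum_mul0.
have R2 b : R (inl h2) b = 0 by case: b => [i|[[] e]]; apply: sum_mul0.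
have Rf f b : R (inr (false, f)) b = 0 by case: b => [i|[[] e]]; apply: sum_mul0.
have Rei e i : R (inr (true, e)) (inl i) = 0 by apply: sum_mul0.
have Ree e e' : R (inr (true, e)) (inr (true, e')) = 0 by apply: sum_mul0.
rewrite /gram sum_gidx -!/R.
have z1 F : \sum_(j : gidx n) F j * R (inl h1) j = 0.
  by rewrite big1 // => j _; rewrite R1 mulr0.
have z2 F : \sum_(j : gidx n) F j * R (inl h2) j = 0.
  by rewrite big1 // => j _; rewrite R2 mulr0.
have zeroEF f F : \sum_(j : gidx n) F j * R (inr (false, f)) j = 0.
  by rewrite big1 // => j _; rewrite Rf mulr0.
rewrite z1 z2 [X in _ + (_ + X)]big1 => [|f _]; last exact: zeroEF.
rewrite !addr0; congr (_ + _).
  rewrite sum_gidx Rgg Rg1 Rg2.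
  under eq_bigr do rewrite Rge.
  rewrite [X in _ + (_ + X)]big1 => [|f _]; last by rewrite Rgf mulr0.
  by rewrite /= !mulrDr big_distrr /= mulr0 add0r addr0 !mulrA; under [in RHS]eq_bigr do rewrite mulrA.
apply: eq_bigr => e _; rewrite sum_gidx !Rei !mulr0 !add0r.
by rewrite big1 ?add0r // => e' _; rewrite Ree mulr0.
Qed.

Lemma EFidx_eq (e f : EFidx n) : same_block e f -> jj_of e = jj_of f -> e = f.
Proof.
case: e f => t [i j] [t' [i' j']] /andP[/eqP/= tt']; rewrite /tt_of /= in tt'.
case: t' / tt' i' j' => i' j' /eqP/val_inj; rewrite /= => ii'.
by case: i' / ii' j' => j' /val_inj; rewrite /= => ->.
Qed.

Lemma EFidx_eqE (e f : EFidx n) : (e == f) = same_block e f && (jj_of e == jj_of f).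
Proof.
apply/eqP/andP => [->|[ef /eqP/(EFidx_eq ef)//]].
by rewrite /same_block !eqxx.
Qed.

Lemma ef_form_diff_block x e f : ~~ same_block e f -> ef_form x e f = 0.
Proof.
move=> ef; rewrite /ef_form /half_form big1 // => l _.
by rewrite /rule -/(same_block e f) (negPf ef) mulr0.
Qed.

Lemma ef_form_lt x e f : (jj_of e < jj_of f)%N -> ef_form x e f = 0.
Proof.
move=> ef; rewrite /ef_form /half_form big1 // => l _.
have [jfe jfe'] : (jj_of f < jj_of e)%N = false /\ (jj_of f == jj_of e) = false by lia.
by rewrite /rule jfe jfe' if_same mulr0.
Qed.

Lemma ef_form_eq x e f : same_block e f -> jj_of e = jj_of f ->
  ef_form x e f = dval (tt_of e) x.
Proof.
move=> ef jef; rewrite /ef_form /half_form sum_gidx.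
rewrite /rule -/(same_block e f) ef jef ltnn eqxx /= !big1 ?mulr0 => [|f' _|e' _];
  rewrite ?mulr0 //.
by rewrite /dval; ring.
Qed.

(** With 0-based indices the bracket of e and f has index [jj_of e - jj_of f - 1], here 0. So the
    subdiagonal is constant, equal to the coordinate of x at the first e of the chain. *)
Lemma ef_form_succ x e f e0 : same_block e f -> jj_of e = (jj_of f).+1 ->
    same_block e0 e -> jj_of e0 = 0%N ->
  ef_form x e f = x (inr (true, e0)).
Proof.
move=> ef jef ee0 j0; rewrite /ef_form -(sum_delta x); apply: eq_bigr => l _.
rewrite /rule -/(same_block e f) ef jef ltnSn; case: l => [//|[[] e3]] //=.
rewrite subSnn subn1 /=; congr (_ * _%:R).
rewrite (inj_eq inr_inj) xpair_eqE eqxx /= EFidx_eqE j0 -/(same_block e3 e).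
by congr (nat_of_bool (_ && _)); move/andP: ee0 => [/eqP te /eqP ie]; rewrite /same_block te ie.
Qed.

(** * The action behind the bracket, and the Jacobi identity *)

(* The abelian subalgebra spanned by g and the f's acts on the abelian ideal
   spanned by the h's and the e's. *)
Definition gact (a b l : gidx n) : C :=
  match a with
  | inl _ => rule alpha beta a b l
  | inr (true, _) => 0
  | inr (false, _) => - rule alpha beta b a l
  end.

Definition in_ideal (a : gidx n) : bool :=
  match a with inl i => val i != 0%N | inr (b, _) => b end.

Lemma gconstE a b l : gconst alpha beta a b l = gact a b l - gact b a l.
Proof.
by rewrite /gconst; case: a => [x|[[] e]]; case: b => [y|[[] f]] //=;
  rewrite ?(subr0, sub0r, oppr0, opprK).
Qed.

Lemma gact_ideall a b l : in_ideal a -> gact a b l = 0.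
Proof.
case: a => [x /= x0|[[] e]] //.
by case: b => [y|[[] f]]; rewrite /= ?(negPf x0).
Qed.

Lemma gact_idealm a b l : ~~ in_ideal b -> gact a b l = 0.
Proof.
case: b => [y /= /negPn/eqP y0|[[] f]] //; case: a => [x|[[] e]] //=; rewrite ?y0 ?oppr0 //.
by rewrite !andbF.
Qed.

Lemma gact_idealr a b l : ~~ in_ideal l -> gact a b l = 0.
Proof.
case: l => [z /= /negPn/eqP z0|[[] l // _]]; case: a => [x|[[] e]]; case: b => [y|[[] f]] //=.
- have zy k : val y == k.+1 -> (inl z == inl y :> gidx n) = false.
    by move=> yk; apply: contraTF yk => /eqP[<-]; rewrite /= z0.
  by case: ifP => [/andP[_ /zy->] //|_]; case: ifP => [/andP[_ /zy->] //|_].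
all: by try rewrite z0; rewrite ?if_same ?oppr0.
Qed.

Lemma gact_g b l : in_ideal b -> gact (inl g0) b l = (l == b)%:R.
Proof.
by case: b => [[[|[|[|//]]] y3]|[[] e]].
Qed.

Arguments gact : simpl never.

(** The values of the action lie in the ideal, where g is the identity. Together with the next lemma
    this makes g commute with every action operator. *)
Lemma gact_g_after a b m :
  \sum_l gact a b l * gact (inl g0) l m = gact a b m.
Proof.
have [mV|mV] := boolP (in_ideal m); last first.
  by rewrite (gact_idealr _ _ mV) big1 // => l _; rewrite (gact_idealr _ _ mV) mulr0.
rewrite (bigD1 m) //= gact_g // eqxx mulr1 big1 ?addr0 // => l lm.
have [lV|lV] := boolP (in_ideal l); last by rewrite gact_idealr // mul0r.
by rewrite gact_g // eq_sym (negPf lm) mulr0.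
Qed.

Lemma gact_g_before a b m :
  \sum_l gact (inl g0) b l * gact a l m = gact a b m.
Proof.
have [bV|bV] := boolP (in_ideal b); last first.
  by rewrite (gact_idealm _ _ bV) big1 // => l _; rewrite (gact_idealm _ _ bV) mul0r.
rewrite (bigD1 b) //= gact_g // eqxx mul1r big1 ?addr0 // => l lb.
by rewrite gact_g // (negPf lb) mul0r.
Qed.

Lemma EFidx_lower (e : EFidx n) k : (k <= jj_of e)%N ->
  exists2 e0, same_block e0 e & jj_of e0 = k.
Proof.
case: e => t [i j] kj; have kn : (k < n i)%N by apply: leq_ltn_trans kj (ltn_ord j).
exists (mkEF (Ordinal kn)) => //.
by rewrite /same_block !eqxx.
Qed.

(* Up to sign, the m-coordinate of [f', [f, e]], in a form symmetric in f and f'. *)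
Definition double_shift (e f f' : EFidx n) (m : gidx n) : C :=
  if same_block e f && same_block e f' then
    match m with
    | inl z => if jj_of e == (jj_of f + jj_of f').+1 then
                 if val z == 1%N then alpha (tt_of e)
                 else if val z == 2%N then beta (tt_of e) else 0
               else 0
    | inr (true, e') => (same_block e' e && (jj_of e == (jj_of e' + jj_of f + jj_of f').+2))%:R
    | inr (false, _) => 0
    end
  else 0.

(** Each f lowers the index along the chain by [jj_of f + 1], so the composition depends only on the
    sum of the two shifts. The sum runs over the e's alone because the h's are killed by the f's. *)
Lemma rule_comp e f f' m :
  \sum_e' rule alpha beta (inr (true, e)) (inr (false, f)) (inr (true, e'))
          * rule alpha beta (inr (true, e')) (inr (false, f')) m
  = double_shift e f f' m.
Proof.
rewrite /double_shift.
have [ef|ef] /= := boolP (same_block e f); last first.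
  by rewrite big1 // => e' _; rewrite /rule -/(same_block e f) (negPf ef) mul0r.
(* If the index of e does not exceed that of f, their bracket has no e-component, and both sides
   vanish. *)
have [fe|fe] := ltnP (jj_of f) (jj_of e); last first.
  have -> : (jj_of e == (jj_of f + jj_of f').+1) = false by lia.
  have e0 e' : (jj_of e == (jj_of e' + jj_of f + jj_of f').+2) = false by lia.
  rewrite big1 => [|e' _]; first by case: m => [z|[[] e']]; rewrite ?e0 ?andbF if_same.
  by rewrite /rule -/(same_block e f) ef if_same mul0r.
(* [e0] is the only intermediate vector contributing to the sum. *)
have [e0 ee0 je0] := @EFidx_lower e (jj_of e - jj_of f - 1)%N ltac:(lia).
have [/eqP te0 /eqP ie0] := andP ee0.
rewrite (bigD1 e0) //= -/(same_block e f) ef te0 ie0 -je0 !eqxx mul1r.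
rewrite big1 ?addr0 => [|e' ne']; last first.
  move: ne'; rewrite EFidx_eqE /same_block te0 ie0 => /negPf->.
  by rewrite mul0r.
rewrite -/(same_block e f'); case: ifP => // ef'.
have -> : (jj_of f' == jj_of e0) = (jj_of e == (jj_of f + jj_of f').+1) by lia.
case: m => [z|[[] e']]; rewrite ?if_same //.
  by case: ltnP => // f'e0; rewrite ifF //; lia.
case: ltnP => f'e0.
  rewrite -/(same_block e' e); congr (nat_of_bool (_ && _))%:R; lia.
have -> : (jj_of e == (jj_of e' + jj_of f + jj_of f').+2) = false by lia.
by rewrite andbF.
Qed.

Lemma gconst_lie_algebra : is_lie_algebra (gconst (n:=n) alpha beta).
Proof.
(* Either [k] lies in the ideal and acts by zero, or it cannot occur in a value of the action. *)
apply: (lie_algebra_of_action gconstE) => [i j k l m|i j c m].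
  have [kV|kV] := boolP (in_ideal k); first by rewrite (gact_ideall _ _ kV) mulr0.
  by rewrite (gact_idealr _ _ kV) mul0r.
(* Elements of the ideal act by zero, so only g and the f's have to be shown to commute. *)
have [iV|iV] := boolP (in_ideal i).
  by rewrite !big1 // => l _; rewrite (gact_ideall _ _ iV) ?mulr0 ?mul0r.
have [jV|jV] := boolP (in_ideal j).
  by rewrite !big1 // => l _; rewrite (gact_ideall _ _ jV) ?mulr0 ?mul0r.
case: i iV => [x /negPn/eqP x0|[[] f] // _].
  have -> : x = g0 by apply: val_inj.
  by rewrite gact_g_after gact_g_before.
case: j jV => [x /negPn/eqP x0|[[] f'] // _].
  have -> : x = g0 by apply: val_inj.
  by rewrite gact_g_after gact_g_before.
have ff (f1 f2 : EFidx n) : \sum_l gact (inr (false, f1)) c l * gact (inr (false, f2)) l m =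
    if c is inr (true, e) then double_shift e f1 f2 m else 0.
  case: c => [y|[[] e]]; try by rewrite big1 // => l _; rewrite {1}/gact oppr0 mul0r.
  rewrite sum_gidx /gact /= oppr0 !mulr0 !add0r [X in _ + X]big1 // addr0 -rule_comp.
  by apply: eq_bigr => e' _; rewrite mulrNN.
rewrite !ff {ff}; case: c => [//|[[] e] //]; rewrite /double_shift andbC.
by case: m => [z|[[] e']]; rewrite // ?[(jj_of f + _)%N]addnC // addnAC.
Qed.

(** * Blocks indexed by the pairs (t, i), and the full skew form *)

Definition bidx : finType := {t : 'I_N & 'I_(p t)}.

Definition bsize (k : bidx) : nat := n (tagged k).

Definition in_block (k : bidx) (e : EFidx n) : bool :=
  (tt_of e == tag k) && (ii_of e == tagged k).

Definition block_elt (k : bidx) (j : 'I_(bsize k)) : EFidx n := mkEF j.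

Lemma sum_block (k : bidx) (F : EFidx n -> C) :
  \sum_(e | in_block k e) F e = \sum_(j < bsize k) F (block_elt j).
Proof.
case: k => t i; rewrite /in_block /block_elt /bsize /=.
(* The nested dependent sum is restricted one tag at a time. *)
transitivity (\sum_(t' | t' == t) \sum_(q : {i : 'I_(p t') & 'I_(n i)} | tag q == i :> nat)
    F (existT (fun t => {i : 'I_(p t) & 'I_(n i)}) t' q)).
  by rewrite sig_big_dep; apply: eq_big => [[t' q]|[t' q] _].
rewrite big_pred1_eq.
transitivity (\sum_(i' | i' == i) \sum_(j : 'I_(n i')) F (mkEF j)); last by rewrite big_pred1_eq.
by rewrite sig_big_dep; apply: eq_big => [[i' j]|[i' j] _] //=; rewrite andbT.
Qed.

Lemma in_block_same (k k' : bidx) e f : k != k' -> in_block k e -> in_block k' f ->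
  ~~ same_block e f.
Proof.
move=> kk' /andP[/eqP te /eqP ie] /andP[/eqP tf /eqP jf]; apply: contra kk'.
rewrite /same_block te ie tf jf => {te ie tf jf}.
case: k k' => t i [t' i'] /= /andP[/eqP tt']; case: t' / tt' i' => i' /eqP/val_inj->.
exact: eqxx.
Qed.

Definition aform (x : gidx n -> C) (a b : gidx n) : C :=
  half_form x a b - half_form x b a.

Lemma AformE x : Aform (gconst (n:=n) alpha beta) x =
  \matrix_(i, j) aform x (enum_val i) (enum_val j).
Proof.
apply/matrixP => i j; rewrite !mxE /aform /half_form -sumrB.
by apply: eq_bigr => l _; rewrite /gconst mulrBr.
Qed.

Lemma gram_aform x u v :
  gram (aform x) u v = gram (half_form x) u v - gram (half_form x) v u.
Proof.
rewrite /gram [X in _ = _ - X]exchange_big -sumrB; apply: eq_bigr => i _.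
rewrite -sumrB; apply: eq_bigr => j _; rewrite /aform; ring.
Qed.

(** * Vectors adapted to a pair (x, a) *)

Definition delta (x a : gidx n -> C) : C := x (inl h1) * a (inl h2) - x (inl h2) * a (inl h1).

Definition zeroEF : EFidx n -> C := fun=> 0.

Definition epair (x : gidx n -> C) (Q : EFidx n -> C) : C := \sum_e Q e * x (inr (true, e)).

(* The combination of the h's is the one making the vector orthogonal to g for both forms. *)
Definition evec (x a : gidx n -> C) (Q : EFidx n -> C) : gidx n -> C :=
  gvec 0 ((epair a Q * x (inl h2) - epair x Q * a (inl h2)) / delta x a)
         ((epair x Q * a (inl h1) - epair a Q * x (inl h1)) / delta x a) Q zeroEF.

Definition fvec (P : EFidx n -> C) : gidx n -> C := gvec 0 0 0 zeroEF P.

(** By Cramer's rule, vectors 1 and 2 are the basis of the span of h_1 and h_2 dual to the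
    restrictions of x and a. *)
Definition kvec (x a : gidx n -> C) (r : nat) : gidx n -> C :=
  match r with
  | 0%N => gvec 1 0 0 zeroEF zeroEF
  | 1%N => gvec 0 (a (inl h2) / delta x a) (- a (inl h1) / delta x a) zeroEF zeroEF
  | _ => gvec 0 (- x (inl h2) / delta x a) (x (inl h1) / delta x a) zeroEF zeroEF
  end.

Lemma sum_zero (x : gidx n -> C) : \sum_e zeroEF e * x (inr (true, e)) = 0.
Proof. by rewrite big1 // => e _; rewrite mul0r. Qed.

Lemma ef_form_zerol x P : \sum_e \sum_f zeroEF e * P f * ef_form x e f = 0.
Proof. by rewrite big1 // => e _; rewrite big1 // => f _; rewrite !mul0r. Qed.

Lemma ef_form_zeror x Q : \sum_e \sum_f Q e * zeroEF f * ef_form x e f = 0.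
Proof. by rewrite big1 // => e _; rewrite big1 // => f _; rewrite mulr0 mul0r. Qed.

Lemma gram_ff x P P' : gram (aform x) (fvec P) (fvec P') = 0.
Proof. by rewrite gram_aform !gram_half_form !ef_form_zerol; ring. Qed.

Lemma gram_fe x y a P Q : gram (aform y) (fvec P) (evec x a Q) =
  - \sum_e \sum_f Q e * P f * ef_form y e f.
Proof. by rewrite gram_aform !gram_half_form !ef_form_zerol; ring. Qed.

Lemma gram_ef x y a P Q : gram (aform y) (evec x a Q) (fvec P) =
  \sum_e \sum_f Q e * P f * ef_form y e f.
Proof. by rewrite gram_aform !gram_half_form !ef_form_zerol; ring. Qed.

Lemma gram_ee x y a Q Q' : gram (aform y) (evec x a Q) (evec x a Q') = 0.
Proof. by rewrite gram_aform !gram_half_form !ef_form_zeror; ring. Qed.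

Lemma gram_kf x y a P r : (r < 3)%N ->
  gram (aform y) (kvec x a r) (fvec P) = 0 /\ gram (aform y) (fvec P) (kvec x a r) = 0.
Proof.
by case: r => [|[|[|//]]] _; rewrite !gram_aform !gram_half_form !ef_form_zerol !sum_zero; split; ring.
Qed.

Lemma gram_ke x y a Q r : delta x a != 0 -> y = x \/ y = a -> (r < 3)%N ->
  gram (aform y) (kvec x a r) (evec x a Q) = 0 /\ gram (aform y) (evec x a Q) (kvec x a r) = 0.
Proof.
move=> d0 ya; case: r => [|[|[|//]]] _; rewrite !gram_aform !gram_half_form !ef_form_zerol !ef_form_zeror;
  try by split; ring.
(* The case of g: the h-part of [evec] cancels its e-part in the pairing with both x and a. *)
rewrite -/(epair y Q); suff -> : (epair a Q * x (inl h2) - epair x Q * a (inl h2)) / delta x a * y (inl h1)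
  + (epair x Q * a (inl h1) - epair a Q * x (inl h1)) / delta x a * y (inl h2) = - epair y Q.
  by split; ring.
by case: ya => ->; move: d0; rewrite /delta => d0; field.
Qed.

Lemma gram_kk x a r s : delta x a != 0 -> (r < 3)%N -> (s < 3)%N ->
  gram (aform x) (kvec x a r) (kvec x a s) = blockA (KB 2) r s /\
  gram (aform a) (kvec x a r) (kvec x a s) = blockB (KB 2) r s.
Proof.
move=> d0; case: r => [|[|[|//]]] _; case: s => [|[|[|//]]] _;
  rewrite !gram_aform !gram_half_form !ef_form_zerol !sum_zero /= /skewblk /kronP /kronQ /=;
  move: d0; rewrite /delta => d0; split; field.
all: by first [exact: d0 | done].
Qed.

(** * The Jordan block of a pair (t, i) *)

Definition lmat (y : gidx n -> C) (k : bidx) : 'M[C]_(bsize k) :=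
  \matrix_(i, j) ef_form y (block_elt i) (block_elt j).

(** Extension by zero from one block. [insub] avoids a transport between dependent ordinals and
    always succeeds inside the block. *)
Definition spread (k : bidx) (w : 'I_(bsize k) -> C) : EFidx n -> C :=
  fun e => if in_block k e then oapp w 0 (insub (jj_of e)) else 0.

Lemma in_block_elt (k : bidx) (j : 'I_(bsize k)) : in_block k (block_elt j).
Proof. by rewrite /in_block !eqxx. Qed.

Lemma same_block_elt (k : bidx) (i j : 'I_(bsize k)) :
  same_block (block_elt i) (block_elt j).
Proof. by rewrite /same_block !eqxx. Qed.

Lemma spread_elt (k : bidx) w (j : 'I_(bsize k)) : spread w (block_elt j) = w j.
Proof. by rewrite /spread in_block_elt /= /jj_of /= valK. Qed.

Lemma spread_out (k : bidx) (w : 'I_(bsize k) -> C) e :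
  ~~ in_block k e -> spread w e = 0.
Proof. by rewrite /spread => /negPf->. Qed.

Lemma sum_supp (k : bidx) (F : EFidx n -> C) :
  (forall e, ~~ in_block k e -> F e = 0) ->
  \sum_e F e = \sum_(j < bsize k) F (block_elt j).
Proof. by move=> F0; rewrite (bigID (in_block k)) /= [X in _ + X]big1 ?addr0 ?sum_block. Qed.

Lemma ef_form_spread y (k : bidx) (q v : 'I_(bsize k) -> C) :
  \sum_e \sum_f spread q e * spread v f * ef_form y e f
  = \sum_i \sum_j q i * v j * lmat y k i j.
Proof.
rewrite (@sum_supp k) => [|e /spread_out e0]; last first.
  by rewrite big1 // => f _; rewrite e0 !mul0r.
apply: eq_bigr => i _; rewrite (@sum_supp k) => [|e /spread_out e0]; last first.
  by rewrite e0 mulr0 mul0r.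
by apply: eq_bigr => j _; rewrite !spread_elt mxE.
Qed.

Lemma ef_form_supp0 y (k k' : bidx) (Q P : EFidx n -> C) : k != k' ->
    (forall e, ~~ in_block k e -> Q e = 0) ->
    (forall e, ~~ in_block k' e -> P e = 0) ->
  \sum_e \sum_f Q e * P f * ef_form y e f = 0.
Proof.
move=> kk' Q0 P0; rewrite big1 // => e _; rewrite big1 // => f _.
have [ke|/Q0->] := boolP (in_block k e); last by rewrite !mul0r.
have [kf|/P0->] := boolP (in_block k' f); last by rewrite mulr0 mul0r.
by rewrite ef_form_diff_block ?mulr0 // (in_block_same kk' ke kf).
Qed.

Definition evalue (x a : gidx n -> C) (t : 'I_N) : C :=
  dval t x / dval t a.

(** At the first e of a chain, the third expression is the subdiagonal entry of L_x - mu L_a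
    multiplied by d_t(a), where mu is the eigenvalue. Clearing denominators keeps every condition
    polynomial. *)
Definition in_general_position (x a : gidx n -> C) : Prop :=
  [/\ delta x a != 0, forall t, dval t a != 0
    & forall e, x (inr (true, e)) * dval (tt_of e) a
                - a (inr (true, e)) * dval (tt_of e) x != 0].

(** [triangular_jordan_pair] applies to L_a and L_x - mu L_a, and mu L_a is then added back. The
    target is transposed, since that lemma puts the ones below the diagonal and [jordanJ] above
    it. *)
Lemma lmat_jordan x a (k : bidx) : in_general_position x a ->
  exists U V : 'M_(bsize k),
    (forall i j, (U *m lmat x k *m V) i j = jordanJ (evalue x a (tag k)) j i) /\
    (forall i j, (U *m lmat a k *m V) i j = idI j i).
Proof.
move=> [_ dt0 e0]; set mu := evalue x a (tag k).
have diag y (i : 'I_(bsize k)) : lmat y k i i = dval (tag k) y.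
  by rewrite mxE ef_form_eq ?same_block_elt.
have upper y (i j : 'I_(bsize k)) : (i < j)%N -> lmat y k i j = 0.
  by move=> ij; rewrite mxE ef_form_lt.
have sub y (i j : 'I_(bsize k)) (n0 : (0 < bsize k)%N) : i = j.+1 :> nat ->
    lmat y k i j = y (inr (true, block_elt (Ordinal n0))).
  by move=> ij; rewrite mxE (@ef_form_succ _ _ _ (block_elt (Ordinal n0))) ?same_block_elt.
have dxE : dval (tag k) x = mu * dval (tag k) a by rewrite divfK.
have dM (i : 'I_(bsize k)) : lmat x k i i - mu * lmat a k i i = 0.
  by rewrite !diag dxE subrr.
have [|||| U [V [UV UMV]]] := @triangular_jordan_pair C _ (lmat a k) (lmat x k - mu *: lmat a k).
- exact: upper.
- by move=> i; rewrite diag.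
- move=> i j; rewrite leq_eqVlt => /orP[/eqP/val_inj<-|ij].
    by have := dM i; rewrite !mxE.
  by have := upper x _ _ ij; have := upper a _ _ ij; rewrite !mxE => -> ->; rewrite mulr0 subrr.
- move=> i j ij; have n0 : (0 < bsize k)%N by apply: leq_ltn_trans _ (ltn_ord i).
  have := sub x _ _ n0 ij; have := sub a _ _ n0 ij; rewrite !mxE => -> ->.
  apply: contraNneq (e0 (block_elt (Ordinal n0))) => z.
  by rewrite {2}/tt_of /= dxE mulrA [_ * mu]mulrC -mulrBl z mul0r.
exists U, V; split=> i j; last by rewrite UV mxE /idI -val_eqE /=; case: (_ == _).
have -> : lmat x k = mu *: lmat a k + (lmat x k - mu *: lmat a k) by rewrite addrC subrK.
rewrite mulmxDr mulmxDl -scalemxAr -scalemxAl UV UMV !mxE /jordanJ.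
have [->|ij] := eqVneq i j; first by rewrite eqxx ltn_eqF // addr0 mulr1.
by rewrite (negPf ij : (i == j :> nat) = false) mulr0 add0r; case: ifP.
Qed.

(** The f's combined by the columns of [V] come first, then the e's combined by the rows of [U]. The
    second clause records the supports, which give orthogonality between different blocks. *)
Lemma block_basis x a (k : bidx) : in_general_position x a ->
  exists w : nat -> gidx n -> C,
    [/\ forall r s, (r < (bsize k).*2)%N -> (s < (bsize k).*2)%N ->
          gram (aform x) (w r) (w s)
            = blockA (JB (Some (evalue x a (tag k))) (bsize k)) r s /\
          gram (aform a) (w r) (w s)
            = blockB (JB (Some (evalue x a (tag k))) (bsize k)) r s
      & forall r, exists P Q, [/\ forall e, ~~ in_block k e -> P e = 0,
          forall e, ~~ in_block k e -> Q e = 0 & w r = fvec P \/ w r = evec x a Q]].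
Proof.
move=> gp; have [U [V [UxV UaV]]] := lmat_jordan k gp.
pose ve r : 'I_(bsize k) -> C := fun j => oapp (V j) 0 (insub r).
(* The sign compensates for f standing before e in the pairing. *)
pose ue r : 'I_(bsize k) -> C := fun j => oapp (fun s => - U s j) 0 (insub (r - bsize k)%N).
exists (fun r => if (r < bsize k)%N then fvec (spread (ve r)) else evec x a (spread (ue r))).
split; last first.
  move=> r; exists (spread (ve r)), (spread (ue r)).
  by split; [exact: spread_out|exact: spread_out|case: ifP => _; [left|right]].
have UV y (M : nat -> nat -> C) : (forall i j, (U *m lmat y k *m V) i j = M j i) ->
   forall r s, (r < bsize k)%N -> (bsize k <= s < (bsize k).*2)%N ->
   \sum_e \sum_f spread (ue s) e * spread (ve r) f * ef_form y e f
     = - M r (s - bsize k)%N.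
  move=> UyV r s rk sk; have sk' : (s - bsize k < bsize k)%N by lia.
  rewrite ef_form_spread -(UyV (Ordinal sk') (Ordinal rk)) !mxE -sumrN exchange_big.
  apply: eq_bigr => j _; rewrite mxE big_distrl -sumrN; apply: eq_bigr => i _.
  by rewrite /ve /ue !insubT /=; ring.
have key y (M : nat -> nat -> C) : (forall i j, (U *m lmat y k *m V) i j = M j i) ->
   forall r s, (r < (bsize k).*2)%N -> (s < (bsize k).*2)%N ->
   gram (aform y)
     (if (r < bsize k)%N then fvec (spread (ve r)) else evec x a (spread (ue r)))
     (if (s < bsize k)%N then fvec (spread (ve s)) else evec x a (spread (ue s)))
   = skewblk (bsize k) M r s.
  move=> UyV r s r2 s2; rewrite /skewblk.
  case: (ltnP r (bsize k)) => rk; case: (ltnP s (bsize k)) => sk /=.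
  - exact: gram_ff.
  - by rewrite gram_fe (UV _ _ UyV) ?sk ?opprK.
  - by rewrite gram_ef (UV _ _ UyV) ?rk.
  - exact: gram_ee.
by move=> r s r2 s2; split; apply: key.
Qed.

(** * Assembling the Kronecker block and the Jordan blocks *)

Definition all_blocks : seq (option (bidx)) :=
  None :: flatten [seq [seq Some (existT (fun t => 'I_(p t)) t i) | i <- enum 'I_(p t)]
                  | t <- enum 'I_N].

Definition block_of (lam : 'I_N -> C) (k : option (bidx)) : jkblock :=
  if k is Some k then JB (Some (lam (tag k))) (bsize k) else KB 2.

Lemma all_blocks_uniq : uniq all_blocks.
Proof.
rewrite /all_blocks cons_uniq; apply/andP; split.
  by apply/negP => /flattenP[_ /mapP[t _ ->] /mapP[]].
apply: (@allpairs_uniq_dep _ (fun t => 'I_(p t)) _ (fun t i => Some (existT _ t i))).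
- exact: enum_uniq.
- by move=> t _; apply: enum_uniq.
- by move=> [t i] [t' i'] _ _ [].
Qed.

Lemma map_all_blocks lam : map (block_of lam) all_blocks = expected_blocks n (Some \o lam).
Proof.
rewrite /all_blocks /expected_blocks /= map_flatten -map_comp; congr (_ :: flatten _).
by apply: eq_map => t /=; rewrite -map_comp.
Qed.

Lemma size_all_blocks lam :
  sumn [seq jk_size (block_of lam k) | k <- all_blocks] = #|gidx n|.
Proof.
rewrite /= map_flatten sumn_flatten -!map_comp card_sum card_ord; congr (3 + _)%N.
rewrite card_prod card_bool card_tagged !sumnE !big_map big_distrr.
apply: eq_bigr => t _ /=; rewrite card_tagged !sumnE !big_map big_distrr.
by apply: eq_bigr => i _; rewrite /= card_ord mul2n.
Qed.

Lemma jk_decomp_general x a : (forall t (i : 'I_(p t)), (0 < n i)%N) ->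
    in_general_position x a ->
  jk_decomp (Aform (gconst (n:=n) alpha beta) x) (Aform (gconst (n:=n) alpha beta) a)
            (expected_blocks n (Some \o evalue x a)).
Proof.
move=> npos gp; have [d0 _ _] := gp.
have [w wP] := fin_all_exists (fun k => block_basis k gp).
rewrite !AformE -map_all_blocks.
apply: (@jk_decomp_stack _ _ _ (fun k => if k is Some k then w k else kvec x a)).
- exact: all_blocks_uniq.
- by case=> [[t i]|//]; apply: npos.
- by case=> [k|]; [apply: pivoted_JB|apply: pivoted_KB2].
- exact: size_all_blocks.
- case=> [k|] r s rk sk; first by case: (wP k) => + _; apply.
  exact: gram_kk.
case=> [k|] [k'|] r s // kk' rk sk.
(* Two distinct Jordan blocks: the e's of one block are orthogonal to the f's of the other, and e's
   and f's are each isotropic. *)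
- case: (wP k) => _ /(_ r)[P [Q [P0 Q0 wr]]]; case: (wP k') => _ /(_ s)[P' [Q' [P'0 Q'0 ws]]].
  have {}kk' : k != k' by apply: contraNneq kk' => ->.
  have kk : k' != k by rewrite eq_sym.
  by split; case: wr => ->; case: ws => ->; rewrite ?gram_ff ?gram_ee ?gram_ef ?gram_fe;
    rewrite ?(ef_form_supp0 _ kk' Q0 P'0) ?(ef_form_supp0 _ kk Q'0 P0) ?oppr0.
- case: (wP k) => _ /(_ r)[P [Q [_ _ [->|->]]]].
    by split; apply: (gram_kf _ _ _ _ _).2.
  by split; apply: (gram_ke _ d0 _ _).2 => //; [left|right].
- case: (wP k') => _ /(_ s)[P [Q [_ _ [->|->]]]].
    by split; apply: (gram_kf _ _ _ _ _).1.
  by split; apply: (gram_ke _ d0 _ _).1 => //; [left|right].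
Qed.

(** * Distinct eigenvalues, and existence of a pair in general position *)

Lemma evalue_inj (x a : gidx n -> C) : (forall t s, t != s -> alpha t * beta s != alpha s * beta t) ->
  in_general_position x a -> injective (Some \o evalue x a).
Proof.
move=> hd [d0 da _] t s [] /eqP; rewrite eqr_div //; apply: contraTeq => ts.
rewrite -subr_eq0 /dval.
have -> : (alpha t * x (inl h1) + beta t * x (inl h2)) * (alpha s * a (inl h1) + beta s * a (inl h2))
   - (alpha s * x (inl h1) + beta s * x (inl h2)) * (alpha t * a (inl h1) + beta t * a (inl h2))
   = (alpha t * beta s - alpha s * beta t) * delta x a by rewrite /delta; ring.
by rewrite mulf_neq0 // subr_eq0 hd.
Qed.

(** Take a_{h_1} = 1 and a_{h_2} = s, with s avoiding the roots of the product of all alpha_t +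
    beta_t X. With x_{h_1} = 0, x_{h_2} = -1, all x_e = 1 and all a_e = 0, [delta] is 1 and the
    third condition becomes d_t(a) != 0. *)
Lemma general_position_nonempty :
  (forall t, (alpha t, beta t) != (0, 0)) ->
  exists x a, in_general_position x a.
Proof.
move=> hab; pose P : {poly C} := \prod_t ((alpha t)%:P + beta t *: 'X).
have /closed_nonrootP[s] : P != 0.
  apply/prodf_neq0 => t _; apply: contra (hab t) => /eqP/polyP z.
  have := z 0%N; have := z 1%N; rewrite !(coefD, coefC, coefZ, coefX, coef0) /=.
  by rewrite mulr0 mulr1 addr0 add0r xpair_eqE => -> ->; rewrite !eqxx.
rewrite /root horner_prod => /prodf_neq0 Ps.
have da t : alpha t + beta t * s != 0.
  by have := Ps t isT; rewrite !hornerE.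
exists (gvec 0 0 (-1) (fun=> 1) (fun=> 0)), (gvec 0 1 s (fun=> 0) (fun=> 0)); split.
- by rewrite /delta /= mul0r mulr1 sub0r opprK oner_neq0.
- by move=> t; rewrite /dval /= mulr1.
- by move=> e; rewrite /dval /= mul0r mul1r subr0 mulr1.
Qed.

End Algebra.

(** * Zariski-open conditions *)

Definition polynomial2 (I : finType) (F : (I -> C) -> (I -> C) -> C) : Prop :=
  exists Q : mpoly.mpoly (#|{: I}| + #|{: I}|) C,
    forall x a, mpoly.meval (pair_coords x a) Q = F x a.

Section Polynomial2.
Import mpoly.
Variable I : finType.
Implicit Types F G : (I -> C) -> (I -> C) -> C.

Lemma polynomial2_cst c : @polynomial2 I (fun _ _ => c).
Proof. by exists (mpoly.mpolyC _ c) => x a; rewrite mpoly.mevalC. Qed.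

Lemma polynomial2_fst i : @polynomial2 I (fun x _ => x i).
Proof.
exists (mpoly.mpolyX C (mpoly.mnm1 (lshift _ (enum_rank i)))) => x a.
by rewrite mpoly.mevalXU /pair_coords (unsplitK (inl (enum_rank i))) enum_rankK.
Qed.

Lemma polynomial2_snd i : @polynomial2 I (fun _ a => a i).
Proof.
exists (mpoly.mpolyX C (mpoly.mnm1 (rshift _ (enum_rank i)))) => x a.
by rewrite mpoly.mevalXU /pair_coords (unsplitK (inr (enum_rank i))) enum_rankK.
Qed.

Lemma polynomial2D F G : polynomial2 F -> polynomial2 G ->
  polynomial2 (fun x a => F x a + G x a).
Proof. by move=> [P FP] [Q GQ]; exists (P + Q) => x a; rewrite mpoly.mevalD FP GQ. Qed.

Lemma polynomial2N F : polynomial2 F -> polynomial2 (fun x a => - F x a).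
Proof. by move=> [P FP]; exists (- P) => x a; rewrite mpoly.mevalN FP. Qed.

Lemma polynomial2M F G : polynomial2 F -> polynomial2 G ->
  polynomial2 (fun x a => F x a * G x a).
Proof. by move=> [P FP] [Q GQ]; exists (P * Q) => x a; rewrite mpoly.mevalM FP GQ. Qed.

Lemma polynomial2_prod (J : finType) (F : J -> (I -> C) -> (I -> C) -> C) :
  (forall j, polynomial2 (F j)) -> polynomial2 (fun x a => \prod_j F j x a).
Proof.
move=> /fin_all_exists[Q FQ]; exists (\prod_j Q j) => x a.
by rewrite rmorph_prod; apply: eq_bigr => j _; apply: FQ.
Qed.

Lemma zariski_open2_neq0 F : polynomial2 F -> zariski_open2 (fun x a => F x a != 0).
Proof.
move=> [Q FQ]; exists (eq Q) => x a; split=> [/negP/negPn/eqP F0 _ <-|/(_ Q erefl)].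
  by rewrite FQ.
by rewrite FQ => ->; rewrite eqxx.
Qed.

End Polynomial2.

Theorem theorem19 (N : nat) (p : 'I_N -> nat)
    (n : forall t : 'I_N, 'I_(p t) -> nat) (alpha beta : 'I_N -> C)
    (hp : forall t, (1 <= p t)%N)
    (hn_pos : forall t i, (0 < n t i)%N)
    (hn_dec : forall t (i j : 'I_(p t)), (i <= j)%N -> (n t j <= n t i)%N)
    (hab : forall t, (alpha t, beta t) != (0, 0))
    (hdist : forall t s, t != s -> alpha t * beta s != alpha s * beta t) :
  is_lie_algebra (gconst (n:=n) alpha beta) /\
  generically2 (fun x a : gidx n -> C =>
    exists lam : 'I_N -> option C, injective lam /\
      jk_decomp (Aform (gconst (n:=n) alpha beta) x) (Aform (gconst (n:=n) alpha beta) a)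
                (expected_blocks n lam)).
Proof.
split; first exact: gconst_lie_algebra.
(* The product of all the conditions: general position is the nonvanishing of one polynomial. *)
pose F (x a : gidx n -> C) : C :=
  delta x a * (\prod_t dval alpha beta t a)
  * \prod_(e : EFidx n) (x (inr (true, e)) * dval alpha beta (tt_of e) a
                         - a (inr (true, e)) * dval alpha beta (tt_of e) x).
have FE x a : F x a != 0 <-> in_general_position alpha beta x a.
  rewrite /F !mulf_eq0 !negb_or; split.
    by move=> /andP[/andP[d0 /prodf_neq0 dt] /prodf_neq0 de]; split=> // t; [apply: dt|apply: de].
  by move=> [-> dt de] /=; apply/andP; split; apply/prodf_neq0 => t _; [apply: dt|apply: de].
exists (fun x a => F x a != 0); split; last split.
- apply: zariski_open2_neq0.
  (* The closure properties enter the context so that [auto] can follow the shape of [F]. *)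
  have cst := @polynomial2_cst (gidx n).
  have fst := @polynomial2_fst (gidx n).
  have snd := @polynomial2_snd (gidx n).
  have ? := @polynomial2D (gidx n); have ? := @polynomial2N (gidx n).
  have ? := @polynomial2M (gidx n).
  do !apply: polynomial2M; try (apply: polynomial2_prod => ?); rewrite /delta /dval; auto 10.
- by have [x [a /FE]] := general_position_nonempty n hab; exists x, a.
(* All eigenvalues are finite, because every d_t(a) is nonzero. *)
move=> x a /FE gp; exists (Some \o evalue alpha beta x a); split.
  exact: evalue_inj gp.
exact: jk_decomp_general.
Qed.
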